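(* Let $m\ge3$ be odd and let $k\ge2$ be an integer. Let $$QD_{m,k}=\langle x,y\mid x^2=y^{2k}=1,\ \overline{[x,y^k]}_m=\overline{[y^k,x]}_m\rangle.$$ Then $(QD_{m,k},\{x,y\})$ is strongly marked and has Property $\mathcal D$.
   Context: Notation. A marked group is a pair $(G,X)$ with $G$ a group and $X\subset G$ a generating set. $o(g)$ is the order of $g$; $\mathbb Z_{o(g)}=\mathbb Z/o(g)\mathbb Z$ if $o(g)$ is finite and $\mathbb Z_{o(g)}=\mathbb Z$ otherwise. The set of syllables is $S(X)=\{x^a\mid x\in X,\ a\in\mathbb Z_{o(x)}\setminus\{0\}\}$. $S(X)^*$ is the free monoid on $S(X)$; its elements are called syllabic words, written as finite sequences, with concatenation written $w\cdot w'$. For $w=(s_1,\dots,s_\ell)$, $\overline w=s_1\cdots s_\ell\in G$. The syllabic length $\lg_{S(X)}(g)$ is the shortest length of a syllabic word $w$ with $\overline w=g$; a word $w$ of length $\ell$ is reduced if $\ell=\lg_{S(X)}(\overline w)$. For $m\ge2$, $[a,b]_m$ is the alternating word $(a,b,a,\dots)$ of length $m$, and $\overline{[a,b]}_m$ is the alternating product $aba\cdots$ with $m$ factors. Strongly marked. $(G,X)$ is strongly marked if $1\notin X$ and, for all $x,y\in X$, $s\in\langle x\rangle\setminus\{1\}$, $t\in\langle y\rangle\setminus\{1\}$: if $st\in S(X)\cup\{1\}$ then $x=y$. M-operations. Type I: if $w=w_1\cdot(s,t)\cdot w_2$ with $s,t\in S(X)$ and $st\in S(X)\cup\{1\}$,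 replace $w$ by $w_1\cdot(st)\cdot w_2$ if $st\ne1$, and by $w_1\cdot w_2$ if $st=1$. Type II: if $w=w_1\cdot[s,t]_m\cdot w_2$ with $s,t\in S(X)$, $m\ge2$, $\overline{[s,t]}_m=\overline{[t,s]}_m$ and $\lg_{S(X)}(\overline{[s,t]}_m)=m$, replace $w$ by $w_1\cdot[t,s]_m\cdot w_2$. A word is M-reduced if its length cannot be shortened by any finite sequence of elementary M-operations. Property $\mathcal D$. $(G,X)$ has Property $\mathcal D$ if (a) every $w\in S(X)^*$ is reduced if and only if it is M-reduced, and (b) for all reduced $w,w'\in S(X)^*$ with $\overline w=\overline{w'}$, one can go from $w$ to $w'$ through a finite sequence of elementary M-operations of type II. *)

(* Defs.v *)
From HB Require Import structures.
From mathcomp Require Import all_boot all_algebra.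
From mathcomp Require Import boolp classical_sets.
From Stdlib Require Import Relation_Operators.

Set Implicit Arguments.
Unset Strict Implicit.
Unset Printing Implicit Defensive.

Local Open Scope quotient_scope.
Local Open Scope classical_set_scope.
Local Open Scope group_scope.

(* The letter (i, false) stands for the generator i, (i, true) for its
   inverse. *)
Definition gword (I : Type) := seq (I * bool).

Definition flip (I : Type) (l : I * bool) : I * bool := (l.1, ~~ l.2).

Definition invw (I : Type) (w : gword I) : gword I := rev (map (@flip I) w).

(* The least congruence on words that cancels inverse letters and contains the
   relations u = v for (u, v) in R; its quotient is <I | R>. *)
Inductive pres_eq (I : eqType) (R : seq (gword I * gword I)) :
    gword I -> gword I -> Prop :=
| pres_refl u : pres_eq R u u
| pres_sym u v : pres_eq R u v -> pres_eq R v u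
| pres_trans u v w : pres_eq R u v -> pres_eq R v w -> pres_eq R u w
| pres_cat u u' v v' :
    pres_eq R u u' -> pres_eq R v v' -> pres_eq R (u ++ v) (u' ++ v')
| pres_cancel l : pres_eq R [:: l; flip l] [::]
| pres_rel u v : (u, v) \in R -> pres_eq R u v.

Definition pres_rel_b (I : eqType) (R : seq (gword I * gword I)) :
  rel (gword I) := fun u v => `[< pres_eq R u v >].

Lemma pres_rel_b_equiv (I : eqType) (R : seq (gword I * gword I)) :
  equiv_class_of (pres_rel_b R).
Proof.
split=> [u|u v|v u w].
- exact/asboolP/pres_refl.
- by apply/asboolP/asboolP; apply: pres_sym.
- by move=> /asboolP uv /asboolP vw; apply/asboolP; apply: pres_trans uv vw.
Qed.

Canonical pres_equiv (I : eqType) (R : seq (gword I * gword I)) :=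
  EquivRelPack (pres_rel_b_equiv R).

Definition pres_group (I : choiceType) (R : seq (gword I * gword I)) :=
  {eq_quot (pres_equiv R)}.

HB.instance Definition _ (I : choiceType) (R : seq (gword I * gword I)) :=
  Choice.on (pres_group R).
HB.instance Definition _ (I : choiceType) (R : seq (gword I * gword I)) :=
  EqQuotient.on (pres_group R).

Definition pres_class (I : choiceType) (R : seq (gword I * gword I))
  (w : gword I) : pres_group R := \pi w.

Definition pres_gen (I : choiceType) (R : seq (gword I * gword I)) (i : I) :
  pres_group R := pres_class R [:: (i, false)].

Definition pres_one (I : choiceType) (R : seq (gword I * gword I)) :
  pres_group R := pres_class R [::].

Definition pres_mul (I : choiceType) (R : seq (gword I * gword I))
  (g h : pres_group R) : pres_group R := pres_class R (repr g ++ repr h).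

Definition pres_inv (I : choiceType) (R : seq (gword I * gword I))
  (g : pres_group R) : pres_group R := pres_class R (invw (repr g)).

Lemma pres_classP (I : choiceType) (R : seq (gword I * gword I))
    (u v : gword I) :
  pres_class R u = pres_class R v <-> pres_eq R u v.
Proof.
split=> [/eqmodP /asboolP //|uv].
by apply/eqmodP/asboolP.
Qed.

Lemma pres_classK (I : choiceType) (R : seq (gword I * gword I))
  (g : pres_group R) : pres_class R (repr g) = g.
Proof. exact: reprK. Qed.

Lemma pres_reprP (I : choiceType) (R : seq (gword I * gword I)) (w : gword I) :
  pres_eq R (repr (pres_class R w)) w.
Proof. by apply/pres_classP; rewrite pres_classK. Qed.

Lemma flipK (I : Type) : involutive (@flip I).
Proof. by case=> i b; rewrite /flip /= negbK. Qed.

Lemma invwK (I : Type) : involutive (@invw I).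
Proof.
by move=> w; rewrite /invw map_rev revK mapK //; apply: flipK.
Qed.

Lemma pres_mulwV (I : eqType) (R : seq (gword I * gword I)) (w : gword I) :
  pres_eq R (w ++ invw w) [::].
Proof.
elim: w => [|l w IHw]; first exact: pres_refl.
rewrite /invw /= rev_cons -cats1 catA -/(invw w).
apply: (pres_trans (v := [:: l] ++ [::] ++ [:: flip l])); last first.
  exact: pres_cancel.
rewrite -cat1s; apply: pres_cat; first exact: pres_refl.
by apply: pres_cat => //; apply: pres_refl.
Qed.

Lemma pres_mulM (I : choiceType) (R : seq (gword I * gword I)) (u v : gword I) :
  pres_mul (pres_class R u) (pres_class R v) = pres_class R (u ++ v).
Proof. by apply/pres_classP/pres_cat; apply: pres_reprP. Qed.

Lemma pres_mulA (I : choiceType) (R : seq (gword I * gword I)) :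
  associative (@pres_mul I R).
Proof.
move=> x y z; rewrite -[x]pres_classK -[y]pres_classK -[z]pres_classK.
by rewrite !pres_mulM catA.
Qed.

Lemma pres_1mul (I : choiceType) (R : seq (gword I * gword I)) :
  left_id (pres_one R) (@pres_mul I R).
Proof. by move=> x; rewrite -[x]pres_classK pres_mulM. Qed.

Lemma pres_mul1 (I : choiceType) (R : seq (gword I * gword I)) :
  right_id (pres_one R) (@pres_mul I R).
Proof. by move=> x; rewrite -[x]pres_classK pres_mulM cats0. Qed.

Lemma pres_mulV (I : choiceType) (R : seq (gword I * gword I)) :
  right_inverse (pres_one R) (@pres_inv I R) (@pres_mul I R).
Proof.
move=> x; rewrite -{1}[x]pres_classK pres_mulM.
exact/pres_classP/pres_mulwV.
Qed.

Lemma pres_Vmul (I : choiceType) (R : seq (gword I * gword I)) :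
  left_inverse (pres_one R) (@pres_inv I R) (@pres_mul I R).
Proof.
move=> x; rewrite -{2}[x]pres_classK pres_mulM.
by apply/pres_classP; rewrite -{2}[repr x]invwK; apply: pres_mulwV.
Qed.

HB.instance Definition _ (I : choiceType) (R : seq (gword I * gword I)) :=
  isGroup.Build (pres_group R) (@pres_mulA I R) (@pres_1mul I R)
    (@pres_mul1 I R) (@pres_Vmul I R) (@pres_mulV I R).

Fixpoint alt (T : Type) (a b : T) (m : nat) : seq T :=
  if m is m'.+1 then a :: alt b a m' else [::].

(* The least n satisfying P, and 0 if there is none. *)
Definition least (P : nat -> Prop) : nat :=
  if pselect (exists n, `[< P n >]) is left exP then ex_minn exP else 0.

(* The order o(g), with the convention that it is 0 when g has infinite order:
   thus Z_{o(g)} is Z / o(g)Z in all cases, and a represents a nonzero class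
   of Z_{o(g)} exactly when o(g) does not divide a. *)
Definition gorder (G : groupType) (g : G) : nat :=
  least (fun n => (0 < n)%N /\ g ^+ n = 1).

Definition expgz (G : groupType) (g : G) (a : int) : G :=
  match a with
  | Posz n => g ^+ n
  | Negz n => g ^- n.+1
  end.

Definition cyc (G : groupType) (g : G) : set G := range (expgz g).

Definition generates (G : groupType) (X : set G) : Prop :=
  forall H : {pred G}, group_closed H -> (forall x, X x -> x \in H) ->
    forall g, g \in H.

Definition syl (G : groupType) (X : set G) : set G :=
  [set s | exists x (a : int),
    [/\ X x, ~~ ((gorder x)%:Z %| a)%Z & s = expgz x a]].

Definition syllabic (G : groupType) (X : set G) (w : seq G) : Prop :=
  forall s, s \in w -> syl X s.

Definition eval (G : groupType) (w : seq G) : G := \prod_(s <- w) s.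

(* Some syllabic word represents g as soon as X generates G, so the default
   value of [least] is irrelevant for marked groups. *)
Definition lg (G : groupType) (X : set G) (g : G) : nat :=
  least (fun n => exists w, [/\ syllabic X w, eval w = g & size w = n]).

Definition reduced (G : groupType) (X : set G) (w : seq G) : Prop :=
  syllabic X w /\ size w = lg X (eval w).

Definition strongly_marked (G : groupType) (X : set G) : Prop :=
  [/\ generates X,
      ~ X 1 &
      forall x y s t : G, X x -> X y -> cyc x s -> s <> 1 -> cyc y t -> t <> 1 ->
        (syl X `|` [set 1]) (s * t) -> x = y].

Inductive Mop1 (G : groupType) (X : set G) : seq G -> seq G -> Prop :=
| Mop1_merge w1 w2 s t : syl X s -> syl X t -> syl X (s * t) -> s * t <> 1 ->
    Mop1 X (w1 ++ [:: s; t] ++ w2) (w1 ++ [:: s * t] ++ w2)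
| Mop1_cancel w1 w2 s t : syl X s -> syl X t -> s * t = 1 ->
    Mop1 X (w1 ++ [:: s; t] ++ w2) (w1 ++ w2).

Inductive Mop2 (G : groupType) (X : set G) : seq G -> seq G -> Prop :=
| Mop2_swap w1 w2 s t m : syl X s -> syl X t -> (2 <= m)%N ->
    eval (alt s t m) = eval (alt t s m) -> lg X (eval (alt s t m)) = m ->
    Mop2 X (w1 ++ alt s t m ++ w2) (w1 ++ alt t s m ++ w2).

Definition Mop (G : groupType) (X : set G) (w w' : seq G) : Prop :=
  Mop1 X w w' \/ Mop2 X w w'.

Definition M_reduced (G : groupType) (X : set G) (w : seq G) : Prop :=
  forall w', clos_refl_trans _ (Mop X) w w' -> (size w <= size w')%N.

Definition property_D (G : groupType) (X : set G) : Prop :=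
  (forall w, syllabic X w -> (reduced X w <-> M_reduced X w)) /\
  (forall w w', reduced X w -> reduced X w' -> eval w = eval w' ->
    clos_refl_trans _ (Mop2 X) w w').

(* The generator x is indexed by false, and y by true. *)
Definition QD_rels (m k : nat) : seq (gword bool * gword bool) :=
  let x := [:: (false, false)] in
  let y n := nseq n (true, false) in
  [:: (x ++ x, [::]);
      (y (2 * k)%N, [::]);
      (flatten (alt x (y k) m), flatten (alt (y k) x m))].

Definition QD (m k : nat) : groupType := pres_group (QD_rels m k).

Definition QDx (m k : nat) : QD m k := pres_gen (QD_rels m k) false.
Definition QDy (m k : nat) : QD m k := pres_gen (QD_rels m k) true.

Lemma pres_class_flatten (I : choiceType) (R : seq (gword I * gword I))
  (ws : seq (gword I)) :
  pres_class R (flatten ws) = eval [seq (pres_class R w : pres_group R) | w <- ws].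
Proof.
rewrite /eval; elim: ws => [|w ws IHws]; first by rewrite big_nil.
by rewrite /= big_cons -IHws -pres_mulM.
Qed.

Lemma pres_class_nseq (I : choiceType) (R : seq (gword I * gword I))
  (i : I) (n : nat) :
  pres_class R (nseq n (i, false)) = (pres_gen R i : pres_group R) ^+ n.
Proof.
elim: n => [|n IHn]; first exact: erefl.
rewrite expgS -IHn; symmetry; exact: (pres_mulM R [:: (i, false)]).
Qed.

Lemma map_alt (T U : Type) (f : T -> U) (a b : T) (m : nat) :
  map f (alt a b m) = alt (f a) (f b) m.
Proof. by elim: m a b => //= m IHm a b; rewrite IHm. Qed.

Lemma QD_relations (m k : nat) :
  [/\ QDx m k ^+ 2 = 1, QDy m k ^+ (2 * k) = 1 &
      eval (alt (QDx m k) (QDy m k ^+ k) m) =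
      eval (alt (QDy m k ^+ k) (QDx m k) m)].
Proof.
split.
- rewrite -(pres_class_nseq (QD_rels m k)); apply/pres_classP/pres_rel.
  by rewrite inE eqxx.
- rewrite -(pres_class_nseq (QD_rels m k)); apply/pres_classP/pres_rel.
  by rewrite !inE eqxx orbT.
- rewrite -!pres_class_nseq -!(map_alt (pres_class (QD_rels m k))).
  rewrite -!pres_class_flatten; apply/pres_classP/pres_rel.
  by rewrite !inE eqxx !orbT.
Qed.

(* Main.v *)
(* QD_{m,k} is the amalgamated product of the dihedral group <x, z>, where
   z = y^k, and the cyclic group <y> over <z>.  Call a word alternating between
   x and powers of y normal if it has no factor [x,z]_m.  The group acts on the normal
   forms z^c [x,z]_i y^{b_1} [x,z]_{i_1} y^{b_2} ... of the amalgam, and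
   applying a normal word to the empty form gives a form that spells this very word, so
   distinct normal words have distinct values.  Conversely, a word that is not
   normal, other than [x,z]_m itself, is shortened by M-operations: as m is odd,
   replacing a factor [x,z]_m by [z,x]_m puts z next to a power of y.  Hence the
   reduced words are the normal words and [x,z]_m, whose only other reduced
   spelling is [z,x]_m. *)
Require Import Defs.
From mathcomp Require Import all_boot all_algebra.
From mathcomp Require Import boolp classical_sets zify.
From Stdlib Require Import Relation_Operators.

Set Implicit Arguments.
Unset Strict Implicit.
Unset Printing Implicit Defensive.

(** * Least witnesses, orders of elements and M-operations in a general marked group *)

Lemma least_min (P : nat -> Prop) n : P n -> P (least P) /\ (least P <= n)%N.
Proof.
move=> Pn; rewrite /least; case: pselect => [exP|[]];
  last by exists n; apply/asboolP.
case: ex_minnP => p /asboolP Pp p_min; split=> //.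
by apply: p_min; apply/asboolP.
Qed.

Lemma least_eq (P : nat -> Prop) n :
  P n -> (forall p, P p -> (n <= p)%N) -> least P = n.
Proof.
by move=> Pn n_min; have [/n_min ? ?] := least_min Pn;
  apply/eqP; rewrite eqn_leq; apply/andP.
Qed.

Section Marked.
Local Open Scope group_scope.
Variables (G : groupType) (X : set G).

Lemma eval_cat (u v : seq G) : eval (u ++ v) = eval u * eval v.
Proof. by rewrite /eval big_cat. Qed.

Lemma gorder_eq (g : G) n : (0 < n)%N -> g ^+ n = 1 ->
  (forall p, (0 < p < n)%N -> g ^+ p <> 1) -> gorder g = n.
Proof.
move=> n_gt0 gn n_min; apply: least_eq => // p [p_gt0 gp].
by rewrite leqNgt; apply/negP => pn; case: (n_min p); rewrite ?p_gt0.
Qed.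

Lemma expg_mod (g : G) n p : g ^+ n = 1 -> g ^+ (p %% n) = g ^+ p.
Proof.
by move=> gn; rewrite {2}(divn_eq p n) expgnDr mulnC expgnA gn expg1n mul1g.
Qed.

Lemma expgz_mod (g : G) n a : (0 < n)%N -> g ^+ n = 1 ->
  expgz g a = g ^+ `|(a %% n)%Z|%N.
Proof.
move=> n_gt0 gn; case: a => p /=; first by rewrite modz_nat expg_mod.
apply: (mulIg (g ^+ p.+1)); rewrite mulVg -expgnDr -(expg_mod _ gn).
(* After multiplication by [g ^+ p.+1], the negative case says that the residue of -(p+1) plus p+1
   is a multiple of [n]. *)
suff -> : ((`|(Negz p %% n)%Z|%N + p.+1) %% n = 0)%N by [].
apply/eqP; rewrite -/(dvdn _ _); apply/dvdnP.
have := divz_eq (Negz p) n; have : (0 <= (Negz p %% n)%Z)%R by rewrite modz_ge0; lia.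
move: (Negz p %/ n)%Z (Negz p %% n)%Z => q r r_ge0 E.
exists `|q|%N; nia.
Qed.

(** The word [w] itself is a witness, so [least] does not fall back on its default value. *)
Lemma lg_spec w : syllabic X w ->
  (exists2 w', reduced X w' & eval w' = eval w) /\ (lg X (eval w) <= size w)%N.
Proof.
move=> w_syl; have [[w' [w'_syl w'w size_w']] lg_le] :=
  @least_min (fun n => exists v, [/\ syllabic X v, eval v = eval w & size v = n])
    (size w) (ex_intro _ w (And3 w_syl erefl erefl)).
by split=> //; exists w' => //; split; rewrite // w'w.
Qed.

Lemma Mop_eval w w' : Mop X w w' -> eval w = eval w'.
Proof.
case=> [[w1 w2 s t _ _ _ _|w1 w2 s t _ _ st]|[w1 w2 s t m _ _ _ st _]];
  rewrite !eval_cat //; last by rewrite st.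
  by rewrite /eval !big_cons big_nil !mulg1 mulgA.
by rewrite /eval !big_cons big_nil mulg1 st mul1g.
Qed.

Lemma syllabic_cat u v : syllabic X (u ++ v) <-> syllabic X u /\ syllabic X v.
Proof.
split=> [uv_syl|[u_syl v_syl] s]; last by rewrite mem_cat => /orP[/u_syl|/v_syl].
by split=> s su; apply: uv_syl; rewrite mem_cat su ?orbT.
Qed.

Lemma syllabic_alt s t m : syl X s -> syl X t -> syllabic X (alt s t m).
Proof.
elim: m s t => // m IHm s t s_syl t_syl r.
by rewrite inE => /predU1P[->|]//; apply: IHm.
Qed.

Lemma Mop_syllabic w w' : Mop X w w' -> syllabic X w -> syllabic X w'.
Proof.
case=> [[w1 w2 s t _ _ st_syl _|w1 w2 s t _ _ _]|[w1 w2 s t m s_syl t_syl _ _ _]];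
  rewrite !syllabic_cat => -[w1_syl [_ w2_syl]] //.
  by split=> //; split=> // r; rewrite inE => /eqP ->.
by do 2?split=> //; apply: syllabic_alt.
Qed.

Lemma Mops_eval w w' : clos_refl_trans _ (Mop X) w w' -> syllabic X w ->
  eval w = eval w' /\ syllabic X w'.
Proof.
elim=> [u v uv u_syl|//|u v r _ IHuv _ IHvr /IHuv[-> /IHvr]//].
by split; [exact: Mop_eval | exact: Mop_syllabic u_syl].
Qed.

(** This half of Property D holds in every marked group: M-operations preserve the value, and [lg]
    is a lower bound for the length of any syllabic word with that value. *)
Lemma reduced_M_reduced w : reduced X w -> M_reduced X w.
Proof.
by case=> w_syl w_red w' /Mops_eval/(_ w_syl)[ww' /lg_spec[_]]; rewrite -ww' -w_red.
Qed.
End Marked.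

(** * Left multiplication in the dihedral group of order 2m *)

Section Dihedral.
Variable m : nat.

(* (c, i) stands for z^c [x,z]_i, where i < m; dihx and dihz are the left
   multiplications by x and z. *)
Definition dih := (bool * nat)%type.

Definition dihz (d : dih) : dih := (~~ d.1, d.2).

(** For [c] true, the last two values come from the braid relation: x z [x,z]_{m-2} = [x,z]_m = z
    [x,z]_{m-1}, and x z [x,z]_{m-1} = x [z,x]_m = x [x,z]_m = z [x,z]_{m-2}. *)
Definition dihx (d : dih) : dih :=
  let: (c, i) := d in
  if c then
    if i.+2 < m then (false, i.+2)
    else if i.+2 == m then (true, m.-1) else (true, m.-2)
  else if i is j.+2 then (true, j) else (false, 1 - i).

(* The position of d on the Cayley cycle 1, x, zx, xzx, ... of length 2m, on
   which x and z move every element by one step, in directions that depend only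
   on the parity of the position. *)
Definition dihpos (d : dih) : nat :=
  let: (c, i) := d in
  if odd i then c + i else if c + i == 0 then 0 else m.*2 - (c + i).

Hypothesis m_ge3 : 3 <= m.
Hypothesis m_odd : odd m.

Lemma dihx_lt d : d.2 < m -> (dihx d).2 < m.
Proof.
case: d => -[] [|[|i]] //= im; do ?[case: ifP => ? /=]; lia.
Qed.

Lemma dihxK d : d.2 < m -> dihx (dihx d) = d.
Proof.
case: d => -[] [|[|i]] //= im; rewrite /dihx;
  do ?[case: ifP => ? /=]; try (by exfalso; lia);
  try (by congr pair; lia).
Qed.

Lemma dihpos_x d : d.2 < m ->
  dihpos (dihx d) = if odd (dihpos d) then (dihpos d).-1 else (dihpos d).+1.
Proof.
case: d => -[] [|[|i]] im; rewrite /dihpos /dihx /= in im *;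
  try case: (boolP (odd i)) => oi;
  rewrite /= ?negbK ?oi; do ?[case: ifP => ? /=; rewrite ?negbK ?oi /=]; lia.
Qed.

Lemma dihpos_z d : d.2 < m ->
  dihpos (dihz d) = if odd (dihpos d)
    then if (dihpos d).+1 == m.*2 then 0 else (dihpos d).+1
    else if dihpos d == 0 then m.*2.-1 else (dihpos d).-1.
Proof.
case: d => -[] [|i] im; rewrite /dihpos /dihz /= ?add0n ?add1n /= in im *;
  try case: (boolP (odd i)) => oi; rewrite /= ?oi;
  do ?[case: ifP => ? /=; rewrite ?oi /=]; lia.
Qed.

Lemma dihpos_lt d : d.2 < m -> dihpos d < m.*2.
Proof. case: d => -[] i im; rewrite /dihpos /= in im *; do ?[case: ifP => ? /=]; lia. Qed.

(** As m is odd, the identity and the forms with [i] odd fill the positions below m, and the other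
    forms fill those from m to 2m-1. *)
Lemma dihpos_inj d d' : d.2 < m -> d'.2 < m -> dihpos d = dihpos d' -> d = d'.
Proof.
case: d => -[] i; case: d' => -[] j; rewrite /dihpos /= => im jm;
  do ?[case: ifP => ? /=] => H; first [exfalso; lia | congr pair; lia].
Qed.

Definition dihact (w : seq bool) (d : dih) : dih :=
  foldr (fun l => if l then dihz else dihx) d w.

Lemma dihact_lt w d : d.2 < m -> (dihact w d).2 < m.
Proof. by move=> dm; elim: w => //= -[] w IH //; apply: dihx_lt. Qed.

(** Each step changes both the parity of the position and the next letter, so the walk keeps its
    direction. The rightmost letter acts first; it is [a (+) ~~ odd n], and together with the parity
    of the start it fixes that direction. *)
Lemma dihpos_alt n a d : d.2 < m -> n <= m.*2 ->
  dihpos (dihact (alt a (~~ a) n) d) =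
  if (a (+) ~~ odd n) (+) ~~ odd (dihpos d)
  then if dihpos d + n < m.*2 then dihpos d + n else dihpos d + n - m.*2
  else if n <= dihpos d then dihpos d - n else dihpos d + m.*2 - n.
Proof.
move=> dm; have := dihpos_lt dm.
elim: n a => [|n IHn] a pm nm /=.
  by case: a; do ?[case: ifP => ?]; lia.
have -> : alt (~~ a) a n = alt (~~ a) (~~ ~~ a) n by rewrite negbK.
have Hlt := dihact_lt (alt (~~ a) (~~ ~~ a) n) dm.
have IH := IHn (~~ a) pm (ltnW nm).
move: (dihact _ d) Hlt IH => d' d'm E.
have -> : dihpos ((if a then dihz else dihx) d') =
  if a then dihpos (dihz d') else dihpos (dihx d') by case: (a).
rewrite dihpos_z // dihpos_x //.
move: (dihpos d') (dihpos d) pm E => q p pm.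
by case: a {IHn}; case: (boolP (odd n)) => on; case: (boolP (odd p)) => op /=;
  do ?[case: ifP => ?]; lia.
Qed.

(** The two words walk m steps in opposite directions on a cycle of length 2m, so both end at the
    antipode of the start. *)
Lemma dih_braid d : d.2 < m ->
  dihact (alt false true m) d = dihact (alt true false m) d.
Proof.
move=> dm; apply: dihpos_inj; try exact: dihact_lt.
have := @dihpos_alt m false d dm; have := @dihpos_alt m true d dm => /= -> //; last lia.
move=> -> //; last lia.
have := dihpos_lt dm; rewrite m_odd /=; do ?[case: ifP => ?]; lia.
Qed.
End Dihedral.

(** * Normal forms of the amalgam and the action on them *)

Section QDGroup.
Variables m k : nat.

(* ((c, i), [:: (b_1, i_1); (b_2, i_2); ...]) stands for
   z^c [x,z]_i y^{b_1} [x,z]_{i_1} y^{b_2} [x,z]_{i_2} ... *)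
Definition tail := seq (nat * nat).
Definition state := (dih * tail)%type.

(** The y^b with 0 < b < k are the nontrivial coset representatives of <z> in <y>. Only the last
    block may be empty, since otherwise two powers of y would be adjacent. *)
Fixpoint tail_ok (T : tail) : bool :=
  if T is (b, j) :: T' then
    [&& 0 < b, b < k, j < m, (j == 0) ==> (T' == [::]) & tail_ok T']
  else true.

Definition state_ok (s : state) : bool := (s.1.2 < m) && tail_ok s.2.

(* Factors a normal form as y^e with e < 2k times a form that is empty or starts
   with x. *)
Definition ysplit (s : state) : nat * (nat * tail) :=
  let: ((c, i), T) := s in
  let e := if c then k else 0 in
  match i, T with
  | 0, (b, j) :: T' => (e + b, (j, T'))
  | _, _ => (e, (i, T))
  end.

Definition yjoin (p : nat * (nat * tail)) : state :=
  let: (e, (j, T)) := p in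
  let b := if k <= e then e - k else e in
  if b == 0 then ((k <= e, j), T) else ((k <= e, 0), (b, j) :: T).

Definition ypair_ok (p : nat * (nat * tail)) : bool :=
  [&& p.1 < k.*2, p.2.1 < m, (p.2.1 == 0) ==> (p.2.2 == [::]) & tail_ok p.2.2].

(** In the coordinates given by [ysplit], left multiplication by y^a is a translation modulo 2k. *)
Definition yact (a : nat) (s : state) : state :=
  yjoin ((a + (ysplit s).1) %% k.*2, (ysplit s).2).

Definition xact (s : state) : state := (dihx m s.1, s.2).

(* In words over nat, 0 stands for x and a > 0 for y^a. *)
Definition lact (l : nat) : state -> state := if l == 0 then xact else yact l.

Definition wact (w : seq nat) (s : state) : state := foldr lact s w.

(* Concatenation, except that a final z of u is merged with an initial power of
   y in v. *)
Fixpoint glue (u v : seq nat) : seq nat :=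
  match u, v with
  | [::], _ => v
  | [:: l], b :: v' => if l == 0 then l :: v else (l + b) :: v'
  | l :: u', _ => l :: glue u' v
  end.

(** A nonempty block [x,z]_j of even length ends in z, which [glue] merges with the next y^b into
    y^{k+b}; this is how exponents above k are spelled although the forms store only b < k. *)
Fixpoint tail_word (T : tail) : seq nat :=
  if T is (b, j) :: T' then b :: glue (alt 0 k j) (tail_word T') else [::].

Definition state_word (s : state) : seq nat :=
  let: ((c, i), T) := s in
  glue (if c then alt k 0 i.+1 else alt 0 k i) (tail_word T).

Definition nrm (w : seq nat) : bool :=
  sorted (fun a b => (a == 0) != (b == 0)) w && ~~ infix (alt 0 k m) w.

Hypothesis m_ge3 : 3 <= m.
Hypothesis m_odd : odd m.
Hypothesis k_ge2 : 2 <= k.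

Lemma ysplit_ok s : state_ok s -> ypair_ok (ysplit s).
Proof.
case: s => -[c [|i]] [|[b j] T]; rewrite /state_ok /ypair_ok /= ?eqxx ?implybT ?andbT //;
  case: c => /=; lia.
Qed.

Lemma yjoin_ok p : ypair_ok p -> state_ok (yjoin p).
Proof.
case: p => e [j T]; rewrite /state_ok /ypair_ok /= => /and4P[ek jm jT T_ok].
by case: ifP => eb /=; rewrite ?jm ?jT ?T_ok ?andbT //=; move: eb; case: ifP; lia.
Qed.

Lemma ysplitK s : state_ok s -> yjoin (ysplit s) = s.
Proof.
case: s => -[c [|i]] [|[b j] T]; rewrite /state_ok /=.
- by move=> _; case: c; rewrite ?leqnn ?subnn // (leqNgt k) (leq_trans _ k_ge2).
- case/and5P => _ b0 bk _ _; case: c; rewrite ?leq_addr ?addKn ?add0n ?(leqNgt k) ?bk /=.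
    by rewrite -if_neg -lt0n b0.
  by rewrite -if_neg -lt0n b0.
- by move=> _; case: c; rewrite ?leqnn ?subnn // (leqNgt k) (leq_trans _ k_ge2).
- by move=> _; case: c; rewrite ?leqnn ?subnn // (leqNgt k) (leq_trans _ k_ge2).
Qed.

Lemma yjoinK p : ypair_ok p -> ysplit (yjoin p) = p.
Proof.
case: p => e [j T]; rewrite /ypair_ok /= => /and4P[ek jm jT T_ok].
case: ifP => eb /=; last by congr pair; move: eb; case: ifP; lia.
suff He : (if k <= e then k else 0) = e.
  by case: j jm jT => [|j] jm /= => [/eqP ->|_]; rewrite He.
by move: eb; case: ifP; lia.
Qed.

Lemma ypair_addl a p : ypair_ok p -> ypair_ok ((a + p.1) %% k.*2, p.2).
Proof.
by case/and4P=> _ jm jT T_ok; rewrite /ypair_ok jm jT T_ok ltn_mod double_gt0 ltnW.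
Qed.

Lemma yact_ok a s : state_ok s -> state_ok (yact a s).
Proof. by move=> s_ok; apply/yjoin_ok/ypair_addl/ysplit_ok. Qed.

Lemma xact_ok s : state_ok s -> state_ok (xact s).
Proof. by case: s => d T /andP[/= dm T_ok]; rewrite /state_ok /= dihx_lt. Qed.

Lemma lact_ok l s : state_ok s -> state_ok (lact l s).
Proof. by rewrite /lact; case: ifP => _; [apply: xact_ok | apply: yact_ok]. Qed.

Lemma wact_ok w s : state_ok s -> state_ok (wact w s).
Proof. by move=> s_ok; elim: w => //= l w; apply: lact_ok. Qed.

Lemma xactK s : state_ok s -> xact (xact s) = s.
Proof. by case: s => d T /andP[/= dm _]; rewrite /xact /= dihxK. Qed.

Lemma yactD a b s : state_ok s -> yact a (yact b s) = yact (a + b) s.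
Proof.
move=> s_ok; rewrite /yact yjoinK /=; last exact/ypair_addl/ysplit_ok.
by rewrite modnDmr addnA.
Qed.

Lemma yact0 s : state_ok s -> yact 0 s = s.
Proof.
move=> s_ok; have /and4P[e_lt _ _ _] := ysplit_ok s_ok.
by rewrite /yact modn_small -?surjective_pairing ?ysplitK.
Qed.

Lemma yact2k s : state_ok s -> yact k.*2 s = s.
Proof.
move=> s_ok; have /and4P[e_lt _ _ _] := ysplit_ok s_ok.
by rewrite /yact modnDl modn_small // -surjective_pairing ysplitK.
Qed.

(** The two actions agree on the amalgamated subgroup: flipping [c] shifts the exponent of [ysplit]
    by k modulo 2k and leaves the rest unchanged. *)
Lemma yactk s : state_ok s -> yact k s = (dihz s.1, s.2).
Proof.
move=> s_ok; have z_ok : state_ok (dihz s.1, s.2) by [].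
case: s s_ok z_ok => -[c i] T s_ok z_ok.
have [e_lt _ _ _] := and4P (ysplit_ok s_ok).
have [f_lt _ _ _] := and4P (ysplit_ok z_ok).
have : (ysplit (dihz (c, i), T)).2 = (ysplit ((c, i), T)).2.
  by rewrite /=; case: (i) T {s_ok z_ok e_lt f_lt} => [|?] [|[? ?] ?].
have : (ysplit (dihz (c, i), T)).1 = (k + (ysplit ((c, i), T)).1) %% k.*2.
  case: i T s_ok z_ok e_lt f_lt => [|i] [|[b j] T] /=; case: c => /=;
  rewrite ?addn0 ?addnn ?modnn //; move=> *;
  rewrite ?addnA ?addnn ?modnDl ?modn_small //; lia.
by rewrite /yact => <- <-; rewrite -surjective_pairing ysplitK.
Qed.

(** Words in x and z act on the leading dihedral part alone, which reduces the braid relation on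
    states to [dih_braid]. *)
Lemma wact_alt b n d T : state_ok (d, T) ->
  wact (alt (if b then k else 0) (if b then 0 else k) n) (d, T) =
  (dihact m (alt b (~~ b) n) d, T).
Proof.
move=> s_ok; elim: n b => //= n IHn b.
have := IHn (~~ b); rewrite !if_neg negbK => ->.
have d_ok : state_ok (dihact m (alt (~~ b) b n) d, T).
  by case/andP: s_ok => /= dm T_ok; rewrite /state_ok /= T_ok dihact_lt.
case: b d_ok => d_ok; rewrite /lact //.
by rewrite gtn_eqF ?yactk // (leq_trans _ k_ge2).
Qed.

Lemma wact_braid s : state_ok s -> wact (alt 0 k m) s = wact (alt k 0 m) s.
Proof.
case: s => d T s_ok; rewrite (@wact_alt false) // (@wact_alt true) // dih_braid //.
by case/andP: s_ok.
Qed.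

(** * Normal words are read back from their action on the empty form *)

Lemma glue_prefix a b n v : prefix (alt a b n) (glue (alt a b n.+1) v).
Proof. by elim: n a b => [|n IHn] a b; [exact: prefix0s | rewrite /= eqxx; apply: IHn]. Qed.

(** Gluing can alter only the last letter of the first word, and leaves even that one intact if it
    is x. *)
Lemma glue_prefix_last0 a b n v :
  (if odd n then b else a) = 0 -> prefix (alt a b n.+1) (glue (alt a b n.+1) v).
Proof.
elim: n a b => [|n IHn] a b /=; first by case: v => [|? ?] -> //=; rewrite eqxx.
by rewrite if_neg => H; rewrite eqxx; apply: IHn.
Qed.

Lemma nrm_behead l w : nrm (l :: w) -> nrm w.
Proof.
case/andP=> /path_sorted w_sorted; rewrite /nrm w_sorted; apply: contra.
by move=> w_infix; apply: infix_trans w_infix (infix_cons _ _).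
Qed.

(** For l > k the form stores z and y^{l-k}, which [glue] merges again. For l = k it stores z alone,
    and the condition on [j] keeps this z from meeting a power of y in [T]. *)
Lemma state_word_yjoin l j T : 0 < l -> (j == 0) ==> (T == [::]) ->
  state_word (yjoin (l, (j, T))) = l :: glue (alt 0 k j) (tail_word T).
Proof.
rewrite /yjoin; case: (ltngtP k l) => [kl|lk|<-] l_gt0 jT.
- by rewrite subn_eq0 leqNgt kl /= gtn_eqF ?subnKC // ltnW // ltnW.
- by rewrite gtn_eqF.
- by rewrite subnn eqxx; case: j T jT => [|j] T //= /eqP ->.
Qed.

(** Normality of the longer word excludes every case in which [l] would cancel, merge or trigger the
    braid relation. *)
Lemma state_word_lact s l : state_ok s -> l < k.*2 ->
  nrm (l :: state_word s) -> state_word (lact l s) = l :: state_word s.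
Proof.
case: s => -[c i] T s_ok lk /andP[w_sorted /negP w_infix].
rewrite /lact; case: (posnP l) lk w_sorted w_infix => [->|l_gt0] lk w_sorted w_infix.
  case: c s_ok w_sorted w_infix => s_ok w_sorted w_infix; last first.
    by case: i w_sorted {s_ok w_infix} => [|[|i]] //=; case: (tail_word T).
  rewrite /xact /=; case: ifP => im; first by case: (i).
  have [/= i_lt _] := andP s_ok.
  (* Now [i] is m-2 or m-1, so the word obtained by prepending x starts with the forbidden factor
     [x,z]_m. *)
  case: w_infix; apply/prefixW.
  have -> : m = m.-1.+1 by lia.
  rewrite [alt _ _ _]/= prefix_cons eqxx /state_word.
  have [->|->] : i = m.-1 \/ i = m.-2 by lia.
    by apply: glue_prefix.
  have -> : m.-1 = m.-2.+1 by lia.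
  (* As m is odd, [z,x]_{m-1} ends in x and survives the gluing entirely. *)
  by apply: glue_prefix_last0; case: ifP => //; lia.
case: c s_ok w_sorted {w_infix} => s_ok w_sorted.
  exfalso; move: w_sorted => /=.
  have k_gt0 : 0 < k by lia.
  by case: i {s_ok} => [|i]; case: (tail_word T) => [|? ?] /=;
    rewrite ?(gtn_eqF k_gt0) /= => /andP[+ _]; lia.
case: i s_ok w_sorted => [|i] s_ok w_sorted.
  case: T s_ok w_sorted => [|[b j] T] s_ok w_sorted.
    by rewrite /yact [ysplit _]/= addn0 modn_small // state_word_yjoin.
  by exfalso; move: w_sorted s_ok => /=; rewrite /state_ok /=; lia.
by rewrite /yact [ysplit _]/= addn0 modn_small // state_word_yjoin //; case: (T).
Qed.

Definition base : state := ((false, 0), [::]).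

Lemma base_ok : state_ok base.
Proof. by rewrite /state_ok /= (ltn_trans _ m_ge3). Qed.

Lemma wactK w : all (gtn k.*2) w -> nrm w -> state_word (wact w base) = w.
Proof.
elim: w => //= l w IHw /andP[lk w_lt] lw_nrm.
have {}IHw := IHw w_lt (nrm_behead lw_nrm).
by rewrite state_word_lact ?IHw // wact_ok // base_ok.
Qed.

(** * Shortening words over [nat] by counterparts of the M-operations *)

Inductive rstep : seq nat -> seq nat -> Prop :=
| rstep_xx w1 w2 : rstep (w1 ++ [:: 0; 0] ++ w2) (w1 ++ w2)
| rstep_merge w1 w2 a b : 0 < a < k.*2 -> 0 < b < k.*2 -> a + b != k.*2 ->
    rstep (w1 ++ [:: a; b] ++ w2) (w1 ++ [:: (a + b) %% k.*2] ++ w2)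
| rstep_cancel w1 w2 a b : 0 < a -> 0 < b -> a + b = k.*2 ->
    rstep (w1 ++ [:: a; b] ++ w2) (w1 ++ w2)
| rstep_braid w1 w2 :
    rstep (w1 ++ alt 0 k m ++ w2) (w1 ++ alt k 0 m ++ w2).

Definition shortens w :=
  exists2 w', clos_refl_trans _ rstep w w' & size w' < size w.

Lemma all_alt (p : pred nat) a b n : p a -> p b -> all p (alt a b n).
Proof. by elim: n a b => //= n IHn a b pa pb; rewrite pa IHn. Qed.

Lemma size_alt (a b : nat) n : size (alt a b n) = n.
Proof. by elim: n a b => //= n IHn a b; rewrite IHn. Qed.

Lemma alt_rcons (a b : nat) n : alt a b n.+1 = rcons (alt a b n) (if odd n then b else a).
Proof.
elim: n a b => // n IHn a b.
by rewrite [LHS]/= -/(alt b a n.+1) IHn /= if_neg.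
Qed.

Lemma rstep_all w w' : rstep w w' -> all (gtn k.*2) w -> all (gtn k.*2) w'.
Proof.
have k2_gt0 : 0 < k.*2 by rewrite double_gt0 (ltnW k_ge2).
case=> [w1 w2|w1 w2 a b _ _ _|w1 w2 a b _ _ _|w1 w2]; rewrite !all_cat.
- by case/and3P=> -> _ ->.
- by rewrite /= ltn_mod k2_gt0 => /and3P[-> _ ->].
- by case/and3P=> -> _ ->.
- by case/and3P=> -> _ ->; rewrite all_alt //=; lia.
Qed.

Lemma merge_shortens w1 w2 a b :
  0 < a < k.*2 -> 0 < b < k.*2 -> shortens (w1 ++ [:: a; b] ++ w2).
Proof.
move=> a_lt b_lt; have [ab|ab] := eqVneq (a + b) k.*2.
  exists (w1 ++ w2); last by rewrite !size_cat /=; lia.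
  by apply/rt_step/rstep_cancel => //; [case/andP: a_lt | case/andP: b_lt].
exists (w1 ++ [:: (a + b) %% k.*2] ++ w2); last by rewrite !size_cat /=; lia.
by apply/rt_step/rstep_merge.
Qed.

Lemma shortens_trans w w' :
  rstep w w' -> size w' = size w -> shortens w' -> shortens w.
Proof.
move=> ww' size_eq [w'' w'w'' lt_w'']; exists w''; last by rewrite -size_eq.
by apply: rt_trans w'w''; apply: rt_step.
Qed.

Lemma sorted_adjacent (T : Type) (e : rel T) w1 a b w2 :
  sorted e (w1 ++ [:: a; b] ++ w2) -> e a b.
Proof.
by case/cat_sorted2 => _ /=; case/andP.
Qed.

Lemma sortedPn (T : Type) (e : rel T) w : ~~ sorted e w ->
  exists w1 a b w2, w = w1 ++ [:: a; b] ++ w2 /\ ~~ e a b.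
Proof.
elim: w => // a [|b w] IHw //=; rewrite negb_and => /orP[ab|/IHw].
  by exists [::], a, b, w.
by case=> w1 [c [d [w2 [-> cd]]]]; exists (a :: w1), c, d, w2.
Qed.

(** Two adjacent letters are both x, which cancel, or both powers of y, which merge or cancel. *)
Lemma unsorted_shortens w : all (gtn k.*2) w ->
  ~~ sorted (fun a b => (a == 0) != (b == 0)) w -> shortens w.
Proof.
move=> w_lt /sortedPn[w1 [a [b [w2 [w_eq ab]]]]]; subst w.
move: w_lt; rewrite !all_cat /= => /and3P[_ /and3P[ak bk _] _].
have [a0|a_gt0] := posnP a; have [b0|b_gt0] := posnP b; subst.
- exists (w1 ++ w2); last by rewrite !size_cat /=; lia.
  exact/rt_step/rstep_xx.
- by move: ab; rewrite eqxx; lia.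
- by move: ab; rewrite eqxx; lia.
- by apply: merge_shortens; rewrite ?a_gt0 ?b_gt0.
Qed.

Lemma not_nrm_shortens w : all (gtn k.*2) w -> ~~ nrm w -> w <> alt 0 k m ->
  shortens w.
Proof.
move=> w_lt; rewrite negb_and negbK orbC.
have [w_sorted|w_unsorted _ _] := boolP (sorted _ w); last exact: unsorted_shortens.
rewrite orbF => /infixP[p [q w_eq]] w_neq; subst w.
have m_pos : m = m.-1.+1 by lia.
have k_lt : 0 < k < k.*2 by lia.
(* As m is odd, [x,z]_m begins and ends with x, so its neighbours are powers of y. The braid move
   turns both of these ends into z, which then merges with a neighbour; one exists because the word
   is not [x,z]_m alone. *)
apply: (shortens_trans (rstep_braid p q)); first by rewrite !size_cat !size_alt.
move: w_lt; rewrite !all_cat => /and3P[p_lt _ q_lt].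
case/lastP: p p_lt w_sorted w_neq => [|p b] p_lt w_sorted w_neq.
  case: q q_lt w_sorted w_neq => [|b q] q_lt w_sorted w_neq.
    by rewrite cats0 in w_neq.
  move: w_sorted; rewrite cat0s m_pos !alt_rcons -!cats1 -!catA.
  move=> /(@sorted_adjacent _ _ (alt 0 k m.-1) _ b q).
  have -> : odd m.-1 = false by lia.
  move=> b_neq0; have b_gt0 : 0 < b by case: (b) b_neq0.
  by apply: (@merge_shortens (alt k 0 m.-1) q k b) => //; rewrite b_gt0; case/andP: q_lt.
move: w_sorted; rewrite m_pos -cats1 -!catA => /(@sorted_adjacent _ _ p b 0).
move=> b_neq0; have b_gt0 : 0 < b by case: (b) b_neq0.
apply: (@merge_shortens p (alt 0 k m.-1 ++ q) b k) => //.
by rewrite b_gt0; move: p_lt; rewrite all_rcons => /andP[].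
Qed.

(** * The action of QD_{m,k} and the values of normal words *)

Local Open Scope group_scope.

Local Notation G := (QD m k).
Local Notation x := (QDx m k).
Local Notation y := (QDy m k).
Local Notation X := ([set x; y]%classic : set G).

(** The inverse of y acts as y^{2k-1}, and x is its own inverse. *)
Definition gact (w : gword bool) (s : state) : state :=
  foldr (fun l => if l.1 then yact (if l.2 then k.*2.-1 else 1%N) else xact) s w.

Lemma gact_cat u v s : gact (u ++ v) s = gact u (gact v s).
Proof. by rewrite /gact foldr_cat. Qed.

Lemma gact_ok w s : state_ok s -> state_ok (gact w s).
Proof.
by move=> s_ok; elim: w => //= -[[] b] w IHw; [apply: yact_ok | apply: xact_ok].
Qed.

Lemma gact_y n s : state_ok s -> gact (nseq n (true, false)) s = yact n s.
Proof.
move=> s_ok; elim: n => [|n IHn] /=; first by rewrite (yact0).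
by rewrite IHn (yactD).
Qed.

Lemma gact_alt b n s : state_ok s ->
  gact (flatten (alt (if b then nseq k (true, false) else [:: (false, false)])
                     (if b then [:: (false, false)] else nseq k (true, false)) n)) s =
  wact (alt (if b then k else 0) (if b then 0 else k) n) s.
Proof.
move=> s_ok; elim: n b => //= n IHn b; rewrite gact_cat.
have := IHn (~~ b); rewrite !if_neg => ->.
case: b; rewrite /lact //.
by rewrite gact_y ?wact_ok // gtn_eqF // (ltnW k_ge2).
Qed.

Lemma gact_pres u v : pres_eq (QD_rels m k) u v ->
  forall s, state_ok s -> gact u s = gact v s.
Proof.
elim=> [//|? ? _ IH s s_ok|? v' ? _ IH1 _ IH2 s s_ok
  |? ? ? ? _ IH1 _ IH2 s s_ok|[[] b] s s_ok|].
- by rewrite IH.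
- by rewrite IH1 ?IH2.
- by rewrite !gact_cat IH2 // IH1 // gact_ok.
- rewrite /= (yactD) // -[RHS](yact2k s_ok); congr (yact _ s).
  by case: b => /=; lia.
- exact: xactK.
- move=> {}u {}v; rewrite !inE => /or3P[]/eqP[-> ->] s s_ok.
  + exact: xactK.
  + by rewrite mul2n gact_y // yact2k.
  + by rewrite (@gact_alt false) // (@gact_alt true) // wact_braid.
Qed.

(** By [gact_pres], the chosen representative does not matter on valid states. *)
Definition qact (g : G) : state -> state := gact (repr g).

Lemma qact_class w s : state_ok s -> qact (pres_class (QD_rels m k) w) s = gact w s.
Proof. by apply: gact_pres; apply: pres_reprP. Qed.

Lemma qactM g h s : state_ok s -> qact (g * h) s = qact g (qact h s).
Proof. by move=> s_ok; rewrite [LHS]qact_class // gact_cat. Qed.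

Definition letter (l : nat) : G := if l == 0 then x else y ^+ l.

Lemma qact_letter l s : state_ok s -> qact (letter l) s = lact l s.
Proof.
rewrite /letter /lact => s_ok; case: eqP => _; first by rewrite qact_class.
by rewrite -pres_class_nseq qact_class // gact_y.
Qed.

Lemma qact_eval w s : state_ok s -> qact (eval (map letter w)) s = wact w s.
Proof.
move=> s_ok; elim: w => [|l w IHw]; first by rewrite /eval big_nil [LHS]qact_class.
by rewrite /eval /= big_cons qactM // -/(eval _) IHw qact_letter ?wact_ok.
Qed.

(** The value of a word determines its action on [base], from which [wactK] recovers the word if it
    is normal. *)
Lemma nrm_eval_inj v w : all (gtn k.*2) v -> all (gtn k.*2) w ->
  nrm v -> nrm w -> eval (map letter v) = eval (map letter w) -> v = w.
Proof.
move=> v_lt w_lt v_nrm w_nrm vw.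
have b_ok : state_ok base := base_ok.
rewrite -(wactK v_lt v_nrm) -(wactK w_lt w_nrm).
by rewrite -!qact_eval // vw.
Qed.

(** * Syllables, and the translation of rewriting steps into M-operations *)

Lemma expy2k : y ^+ k.*2 = 1.
Proof. by have [_ + _] := QD_relations m k; rewrite mul2n. Qed.

Lemma nrm_short w : sorted (fun a b => (a == 0) != (b == 0)) w ->
  (size w < m)%N -> nrm w.
Proof.
move=> w_sorted w_lt; rewrite /nrm w_sorted; apply/negP => /size_infix.
by rewrite size_alt leqNgt w_lt.
Qed.

Lemma letter_neq1 l : (l < k.*2)%N -> letter l <> 1.
Proof.
move=> lk l1; suff: [:: l] = [::] by [].
apply: nrm_eval_inj; rewrite /= ?lk //; try by apply: nrm_short => //=; lia.
by rewrite /eval big_seq1 big_nil.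
Qed.

Lemma gorder_x : gorder x = 2.
Proof.
apply: gorder_eq => // [|[|[|p]] // _].
  by have [] := QD_relations m k.
by apply: (@letter_neq1 0); lia.
Qed.

Lemma gorder_y : gorder y = k.*2.
Proof.
apply: gorder_eq => [||[|p] // p_lt]; [lia | exact: expy2k |].
exact: (@letter_neq1 p.+1).
Qed.

(** The only syllable of x is x itself, and y^0 is no syllable, so the code 0 is free for x and the
    codes below 2k cover all syllables. *)
Lemma sylP s : syl X s <-> exists2 l, (l < k.*2)%N & s = letter l.
Proof.
split=> [[_ [a [[->|->]]]]|[l lk ->]].
- rewrite gorder_x => a_odd ->; exists 0; first lia.
  rewrite (@expgz_mod _ _ 2) //; last by have [] := QD_relations m k.
  suff -> : `|(a %% 2)%Z|%N = 1%N by [].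
  by move: a_odd; lia.
- rewrite gorder_y => a_ndvd ->.
  have k2_gt0 : (0 < k.*2)%N by lia.
  exists `|(a %% k.*2)%Z|%N; last first.
    rewrite /letter (expgz_mod a k2_gt0 expy2k) ifN //.
    by rewrite absz_eq0; apply: contra a_ndvd => /eqP/dvdz_mod0P.
  have := @ltz_pmod a k.*2; have := @modz_ge0 a k.*2; lia.
- case: (posnP l) lk => [-> _|l_gt0 lk].
    by exists x, 1%R; split; [left | rewrite gorder_x | rewrite /letter].
  exists y, (Posz l); split; [by right | | by rewrite /letter gtn_eqF].
  by rewrite gorder_y dvdzE /= gtnNdvd.
Qed.

Lemma syllabicP w :
  syllabic X w <-> exists2 v, all (gtn k.*2) v & w = map letter v.
Proof.
split=> [|[v v_lt ->] s /mapP[l lv ->]]; last first.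
  by apply/sylP; exists l => //; apply: (allP v_lt).
elim: w => [_|s w IHw sw_syl]; first by exists [::].
have [|l lk ->] := (sylP s).1; first by apply: sw_syl; rewrite inE eqxx.
have [|v v_lt ->] := IHw; first by move=> t tw; apply: sw_syl; rewrite inE tw orbT.
by exists (l :: v); rewrite //= lk.
Qed.

Lemma letter_syl l : (l < k.*2)%N -> syl X (letter l).
Proof. by move=> lk; apply/sylP; exists l. Qed.

Lemma letterM a b : (0 < a)%N -> (0 < b)%N ->
  letter a * letter b = y ^+ ((a + b) %% k.*2).
Proof. by move=> a_gt0 b_gt0; rewrite (expg_mod _ expy2k) expgnDr /letter !gtn_eqF. Qed.

Lemma letterxx : letter 0 * letter 0 = 1.
Proof. by have [] := QD_relations m k. Qed.

Lemma eval_braid : eval (map letter (alt 0 k m)) = eval (map letter (alt k 0 m)).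
Proof.
rewrite !map_alt; have [_ _] := QD_relations m k.
by rewrite /letter (gtn_eqF (ltnW k_ge2)).
Qed.

(** The braid step is kept apart: to be of type II it needs the length condition on [x,z]_m, which
    is proved only in [lg_alt]. Until then only its invariance of value is used. *)
Lemma rstep_cases v v' : all (gtn k.*2) v -> rstep v v' ->
  Mop1 X (map letter v) (map letter v') \/
  exists w1 w2, v = w1 ++ alt 0 k m ++ w2 /\ v' = w1 ++ alt k 0 m ++ w2.
Proof.
move=> v_lt vv'.
case: vv' v_lt => [w1 w2|w1 w2 a b a_lt b_lt ab|w1 w2 a b a_gt0 b_gt0 ab|w1 w2] v_lt;
  last (by right; exists w1, w2); rewrite !map_cat; left.
- apply: Mop1_cancel; try exact: letterxx; by apply: letter_syl; lia.
- have abE : letter a * letter b = letter ((a + b) %% k.*2).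
    rewrite letterM; [|lia|lia]; rewrite /letter ifN //.
    (* If the residue were 0, then 0 < a + b < 4k would force a + b = 2k, which is excluded. *)
    apply/negP => /eqP; have := divn_eq (a + b) k.*2.
    by case: (_ %/ _)%N => [|[|q]]; nia.
  have ab_lt : ((a + b) %% k.*2 < k.*2)%N by rewrite ltn_mod; lia.
  rewrite [map letter [:: _]]/= -abE.
  by apply: Mop1_merge; rewrite ?abE; [apply: letter_syl; lia..| exact: letter_neq1].
- apply: Mop1_cancel; try (by apply: letter_syl; lia).
  by rewrite letterM // ab modnn.
Qed.

Lemma rsteps_eval v v' : clos_refl_trans _ rstep v v' -> all (gtn k.*2) v ->
  all (gtn k.*2) v' /\ eval (map letter v) = eval (map letter v').
Proof.
elim=> [u w uw u_lt|//|u w r _ IHuw _ IHwr /IHuw[/IHwr[r_lt <-]]//].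
split; first exact: rstep_all uw u_lt.
have [uw1|[w1 [w2 [-> ->]]]] := rstep_cases u_lt uw;
  first by apply: (@Mop_eval _ X); left.
by rewrite !map_cat !eval_cat eval_braid.
Qed.

(** * The reduced words and the connections between them *)

Definition good v := all (gtn k.*2) v /\ (nrm v \/ v = alt 0 k m).

(* [x,z]_m is not normal, but [z,x]_m is. *)
Definition canon v := if v == alt 0 k m then alt k 0 m else v.

(** By length, a factor [x,z]_m of [z,x]_m would be the whole word, but the first letters differ. *)
Lemma alt_nrm : nrm (alt k 0 m).
Proof.
apply/andP; split.
  have alt_sorted a b n : (a == 0%N) != (b == 0%N) ->
      sorted (fun a b => (a == 0) != (b == 0))%N (alt a b n).
    elim: n a b => [|[|n] IHn] a b ab //.
    by apply/andP; split=> //; apply: IHn; rewrite eq_sym.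
  by apply: alt_sorted; lia.
apply/negP => /infixP[p [q]] E.
have /eqP := congr1 size E; rewrite !size_cat !size_alt => /eqP sz.
have p0 : p = [::] by apply/nilP; rewrite /nilp; lia.
have q0 : q = [::] by apply/nilP; rewrite /nilp; lia.
move: E; rewrite p0 q0 cats0 /=; case: (m) m_ge3 => // n _ [/eqP]; lia.
Qed.

Lemma good_canon_inj v w : good v -> good w ->
  eval (map letter v) = eval (map letter w) -> canon v = canon w.
Proof.
have canonP u : good u -> [/\ all (gtn k.*2) (canon u), nrm (canon u) &
    eval (map letter (canon u)) = eval (map letter u)].
  rewrite /canon => -[u_lt u_good]; case: eqP u_good => [-> _|_ [//|//]].
  by split; [apply: all_alt => /=; lia | exact: alt_nrm | rewrite eval_braid].
move=> /canonP[v_lt v_nrm <-] /canonP[w_lt w_nrm <-].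
exact: nrm_eval_inj.
Qed.

Lemma size_canon v : size (canon v) = size v.
Proof. by rewrite /canon; case: eqP => [->|//]; rewrite !size_alt. Qed.

Lemma good_or_shortens v : all (gtn k.*2) v -> good v \/ shortens v.
Proof.
move=> v_lt; have [v_nrm|v_nnrm] := boolP (nrm v); first by left; split=> //; left.
have [v_alt|v_nalt] := eqVneq v (alt 0 k m); first by left; split=> //; right.
by right; apply: not_nrm_shortens => //; apply/eqP.
Qed.

Lemma reduced_good w : reduced X w -> exists2 v, good v & w = map letter v.
Proof.
case=> /syllabicP[v v_lt ->] w_red; exists v => //.
have [//|[v' vv' lt_v']] := good_or_shortens v_lt.
have [v'_lt vv'E] := rsteps_eval vv' v_lt.
have v'_syl : syllabic X (map letter v') by apply/syllabicP; exists v'.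
have [_] := lg_spec v'_syl.
by rewrite -vv'E -w_red !size_map leqNgt lt_v'.
Qed.

Lemma good_size v w : good v -> good w ->
  eval (map letter v) = eval (map letter w) -> size v = size w.
Proof.
move=> v_good w_good vw.
by rewrite -size_canon (good_canon_inj v_good w_good vw) size_canon.
Qed.

(** A shortest word with the same value is good by [reduced_good], and good words of equal value
    have equal length. *)
Lemma good_reduced v : good v -> reduced X (map letter v).
Proof.
move=> v_good; have v_syl : syllabic X (map letter v).
  by apply/syllabicP; exists v; case: v_good.
split=> //; have [[w w_red wv] _] := lg_spec v_syl.
case: (w_red) => _; rewrite wv => <-.
have [u u_good w_eq] := reduced_good w_red; rewrite w_eq !size_map in wv *.
exact: good_size.
Qed.

(** This is the length condition that makes the braid step an M-operation of type II. *)
Lemma lg_alt : lg X (eval (map letter (alt 0 k m))) = m.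
Proof.
have [] : reduced X (map letter (alt 0 k m)).
  by apply: good_reduced; split; [apply: all_alt => /=; lia | right].
by rewrite size_map size_alt => _ <-.
Qed.

Lemma rstep_Mop v v' : all (gtn k.*2) v -> rstep v v' ->
  Mop X (map letter v) (map letter v').
Proof.
move=> v_lt vv'; have [|[w1 [w2 [-> ->]]]] := rstep_cases v_lt vv'; first by left.
right; rewrite !map_cat !map_alt.
apply: Mop2_swap; rewrite -?map_alt; try (by apply: letter_syl; lia).
- lia.
- exact: eval_braid.
- exact: lg_alt.
Qed.

Lemma rsteps_Mops v v' : clos_refl_trans _ rstep v v' -> all (gtn k.*2) v ->
  clos_refl_trans _ (Mop X) (map letter v) (map letter v').
Proof.
elim=> [u w uw u_lt|u _|u w r uw IHuw _ IHwr u_lt]; [|exact: rt_refl|].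
  exact/rt_step/rstep_Mop.
have [w_lt _] := rsteps_eval uw u_lt.
exact: rt_trans (IHuw u_lt) (IHwr w_lt).
Qed.

Lemma M_reduced_reduced w : syllabic X w -> M_reduced X w -> reduced X w.
Proof.
move=> /syllabicP[v v_lt ->] w_Mred.
have [|[v' vv' lt_v']] := good_or_shortens v_lt; first exact: good_reduced.
have := w_Mred _ (rsteps_Mops vv' v_lt).
by rewrite !size_map leqNgt lt_v'.
Qed.

Lemma reduced_Mop2 w w' : reduced X w -> reduced X w' -> eval w = eval w' ->
  clos_refl_trans _ (Mop2 X) w w'.
Proof.
move=> /reduced_good[v v_good ->] /reduced_good[v' v'_good ->] vv'.
have alt_lg : lg X (eval (map letter (alt k 0 m))) = m by rewrite -eval_braid lg_alt.
have x_syl : syl X (letter 0) by apply: letter_syl; lia.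
have z_syl : syl X (letter k) by apply: letter_syl; lia.
have := eval_braid; rewrite !map_alt => br.
have := good_canon_inj v_good v'_good vv'; rewrite /canon.
(* The canonical words agree, so the words coincide unless exactly one is [x,z]_m; the other is then
   [z,x]_m, and a single swap joins them. *)
case: eqP => [->|_]; case: eqP => [->|_] E; first exact: rt_refl.
- rewrite -E !map_alt -[alt (letter 0) _ _]cats0 -[alt (letter k) _ _]cats0.
  apply/rt_step/(Mop2_swap [::]) => //; first lia.
  by rewrite -map_alt lg_alt.
- rewrite E !map_alt -[alt (letter 0) _ _]cats0 -[alt (letter k) _ _]cats0.
  apply/rt_step/(Mop2_swap [::]) => //; first lia.
  by rewrite -map_alt alt_lg.
- by rewrite E; apply: rt_refl.
Qed.

(** * Generation and strong marking *)

Lemma QD_generated : generates X.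
Proof.
move=> H H_grp H_gen g; rewrite -[g]pres_classK; elim: (repr g) => [|[i b] w IHw].
  by case: H_grp.
rewrite -cat1s -pres_mulM; apply: (group_closedM H_grp) => //.
have gen_H : pres_gen (QD_rels m k) i \in H by case: i; apply: H_gen; [right | left].
case: b => //.
suff -> : pres_class (QD_rels m k) [:: (i, true)] = (pres_gen (QD_rels m k) i : G)^-1.
  exact: (group_closedV H_grp).
apply: (mulgI (pres_gen (QD_rels m k) i : G)); rewrite mulgV.
rewrite [LHS](pres_mulM (QD_rels m k) [:: (i, false)]).
exact/pres_classP/(pres_cancel _ (i, false)).
Qed.

Lemma cyc_x s : cyc x s -> s <> 1 -> s = letter 0.
Proof.
case=> a _ <-; rewrite (@expgz_mod _ _ 2) //; last by have [] := QD_relations m k.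
have : (`|(a %% 2)%Z| < 2)%N by lia.
by case: `|_|%N => [|[|]].
Qed.

Lemma cyc_y s : cyc y s -> s <> 1 -> exists2 l, (0 < l < k.*2)%N & s = letter l.
Proof.
case=> a _ <-; have k2_gt0 : (0 < k.*2)%N by lia.
rewrite (expgz_mod a k2_gt0 expy2k).
have : (`|(a %% k.*2)%Z| < k.*2)%N.
  by have := @ltz_pmod a k.*2; have := @modz_ge0 a k.*2; lia.
by case: `|_|%N => [|l] // l_lt _; exists l.+1.
Qed.

(** The word of length 2 is too short to contain [x,z]_m, hence normal, so its value differs from
    those of the empty word and of all words of length 1. *)
Lemma alternating_pair a b : (a < k.*2)%N -> (b < k.*2)%N ->
  (a == 0%N) != (b == 0%N) -> ~ (syl X `|` [set 1])%classic (letter a * letter b).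
Proof.
move=> ak bk ab; have ab_nrm : nrm [:: a; b] by apply: nrm_short; rewrite /= ?ab.
have abE : letter a * letter b = eval (map letter [:: a; b]).
  by rewrite /eval !big_cons big_nil mulg1.
case=> [/sylP[l lk]|] abl.
  suff: [:: a; b] = [:: l] by [].
  apply: nrm_eval_inj; rewrite /= ?ak ?bk ?lk //; first by apply: nrm_short => //=; lia.
  by rewrite -abE abl /eval big_seq1.
suff: [:: a; b] = [::] by [].
apply: nrm_eval_inj; rewrite /= ?ak ?bk //; first by apply: nrm_short => //=; lia.
by rewrite -abE abl /eval big_nil.
Qed.

Lemma QD_strongly_marked : strongly_marked X.
Proof.
split; first exact: QD_generated.
  case=> one_eq; [apply: (@letter_neq1 0) | apply: (@letter_neq1 1)];
    rewrite -?one_eq //; lia.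
move=> u v s t [->|->] [->|->] //.
- move=> /cyc_x s_x /s_x -> /cyc_y t_y /t_y[l l_lt ->] /alternating_pair[]; lia.
- move=> /cyc_y s_y /s_y[l l_lt ->] /cyc_x t_x /t_x -> /alternating_pair[]; lia.
Qed.

Lemma QD_property_D : property_D X.
Proof.
split; last exact: reduced_Mop2.
by move=> w w_syl; split; [exact: reduced_M_reduced | exact: M_reduced_reduced].
Qed.

End QDGroup.

Theorem proposition2p4 (m k : nat) (hm : (3 <= m)%N) (hodd : odd m)
    (hk : (2 <= k)%N) :
  strongly_marked ([set QDx m k; QDy m k]%classic : set (QD m k)) /\
  property_D ([set QDx m k; QDy m k]%classic : set (QD m k)).
Proof. by split; [exact: QD_strongly_marked | exact: QD_property_D]. Qed.
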